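(* Let $\Phi=(\{E_i\}_{i=0}^d;\{E^*_i\}_{i=0}^d)$ be a symmetric idempotent system on $V$, with associated scalars $\nu$ and $k_i$ $(0\le i\le d)$. Then the following hold: (i) $k_i\ne 0$ for $0\le i\le d$; (ii) $\nu=\sum_{i=0}^d k_i$; (iii) $k_0=1$.
   Context: $\mathbb{F}$ is a field, $d\ge 0$ an integer, $V$ a vector space over $\mathbb{F}$ of dimension $d+1$, $\mathrm{End}(V)$ the $\mathbb{F}$-algebra of linear maps $V\to V$; $\mathrm{tr}$ means trace. An antiautomorphism of an algebra $\mathcal{A}$ is an $\mathbb{F}$-linear bijection $\tau:\mathcal{A}\to\mathcal{A}$ with $(YZ)^\tau=Z^\tau Y^\tau$. Idempotent system on $V$: a sequence $\Phi=(\{E_i\}_{i=0}^d;\{E^*_i\}_{i=0}^d)$ of elements of $\mathrm{End}(V)$ such that $E_iE_j=\delta_{i,j}E_i$, $\mathrm{rank}(E_i)=1$, $E^*_iE^*_j=\delta_{i,j}E^*_i$, $\mathrm{rank}(E^*_i)=1$, $E_0E^*_iE_0\neq 0$, $E^*_0E_iE^*_0\ne 0$ for $0\le i,j\le d$. It is symmetric if there is an antiautomorphism $\dagger$ of $\mathrm{End}(V)$ fixing each $E_i$ and each $E^*_i$. $\mathcal{M}$ (resp. $\mathcal{M}^*$) is the subalgebra of $\mathrm{End}(V)$ generated by $\{E_i\}_{i=0}^d$ (resp. $\{E^*_i\}_{i=0}^d$); these elements form a basis of it. $\nu=\mathrm{tr}(E_0E^*_0)^{-1}$ (this trace is nonzero).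 $\rho^*:\mathcal{M}^*\to\mathcal{M}$ is the unique $\mathbb{F}$-linear map with $ZE_0E^*_0=Z^{\rho^*}E^*_0$ for all $Z\in\mathcal{M}^*$. For $0\le i\le d$, $A_i=\nu(E^*_i)^{\rho^*}\in\mathcal{M}$, and $k_i$ is the eigenvalue of $A_i$ corresponding to $E_0$, i.e. $A_iE_0=k_iE_0$. *)

(* Defs.v *)
From mathcomp Require Import all_boot all_algebra.
Set Implicit Arguments.
Unset Strict Implicit.
Unset Printing Implicit Defensive.
Import GRing.Theory.
Local Open Scope ring_scope.

(* Throughout, the product Y Z of End(V) is composition, (Y \o Z)%VF. *)

Section Endomorphisms.
Variables (F : fieldType) (V : vectType F).

Definition rank (f : 'End(V)) : nat := \dim (limg f).

(* [vbasis fullv] is only a choice of basis: the trace does not depend on it. *)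
Definition trace (f : 'End(V)) : F :=
  \tr (passmx.mxof (vbasis {:V}) (vbasis {:V}) f).

Definition antiautomorphism (tau : {linear 'End(V) -> 'End(V)}) : Prop :=
  bijective tau /\ forall Y Z : 'End(V), tau (Y \o Z)%VF = (tau Z \o tau Y)%VF.

Definition subalgebra (S : {vspace 'End(V)}) : Prop :=
  \1%VF \in S /\
  forall Y Z : 'End(V), Y \in S -> Z \in S -> (Y \o Z)%VF \in S.

(* Membership in the smallest subalgebra containing all the [G i]. *)
Definition subalgebra_gen (I : finType) (G : I -> 'End(V)) (X : 'End(V)) : Prop :=
  forall S : {vspace 'End(V)},
    subalgebra S -> (forall i, G i \in S) -> X \in S.

End Endomorphisms.

Section IdempotentSystems.
Variables (F : fieldType) (V : vectType F) (d : nat).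
Variables E Es : 'I_d.+1 -> 'End(V).

Definition idempotent_system : Prop :=
  [/\ forall i j, (E i \o E j)%VF = (if i == j then E i else 0)
        /\ (Es i \o Es j)%VF = (if i == j then Es i else 0),
      forall i, rank (E i) = 1%N,
      forall i, rank (Es i) = 1%N,
      forall i, (E ord0 \o Es i \o E ord0)%VF <> 0
    & forall i, (Es ord0 \o E i \o Es ord0)%VF <> 0].

Definition symmetric_system : Prop :=
  exists dag : {linear 'End(V) -> 'End(V)},
    [/\ antiautomorphism dag, forall i, dag (E i) = E i
      & forall i, dag (Es i) = Es i].

Definition nu : F := (trace (E ord0 \o Es ord0)%VF)^-1.

(* The map rho^* : M^* -> M, where M = [subalgebra_gen E] and
   M^* = [subalgebra_gen Es]; the values of [rho] outside M^* are unconstrained. *)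
Definition is_rho_star (rho : 'End(V) -> 'End(V)) : Prop :=
  [/\ forall Z, subalgebra_gen Es Z -> subalgebra_gen E (rho Z),
      forall (c : F) Y Z, subalgebra_gen Es Y -> subalgebra_gen Es Z ->
        rho (c *: Y + Z) = c *: rho Y + rho Z
    & forall Z, subalgebra_gen Es Z ->
        (Z \o E ord0 \o Es ord0)%VF = (rho Z \o Es ord0)%VF].

Definition A_elt (rho : 'End(V) -> 'End(V)) (i : 'I_d.+1) : 'End(V) :=
  nu *: rho (Es i).

End IdempotentSystems.

(* Main.v *)
Require Import Defs.
From HB Require Import structures.
From mathcomp Require Import all_boot all_algebra.
Local Open Scope ring_scope.

Set Implicit Arguments.
Unset Strict Implicit.
Unset Printing Implicit Defensive.
Import GRing.Theory passmx.

(** Every scalar in the statement is a trace.  A rank one map [f] has the form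
    [v |-> phi v *: u], so [f g f = tr(f g) f] for every endomorphism [g]
    ([rank1_sandwich]).  The element [A_i] is determined by
    [A_i E*_0 = nu E*_i E_0 E*_0], and it commutes with [E_0] because it lies in
    the algebra generated by the [E_j] ([subalgebra_gen_comm]).  Multiplying by
    [E_0] on the left therefore gives
    [k_i E_0 E*_0 = nu E_0 E*_i E_0 E*_0 = nu tr(E_0 E*_i) E_0 E*_0], that is,
    [k_i = nu tr(E_0 E*_i)].

    The three claims are read off from this formula.  The trace [tr(E_0 E*_i)]
    is nonzero since [E_0 E*_i E_0] is.  The [E*_i] are [dim V] orthogonal
    idempotents of rank one, so they add up to the identity
    ([sum_rank1_idempotents]) and the traces add up to [tr E_0 = 1].  For
    [i = 0] the trace is [nu^-1] by the definition of [nu]. *)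

Section RankOne.
Variables (F : fieldType) (V : vectType F).
Implicit Types f g h : 'End(V).

Lemma traceE f :
  trace f = \sum_i coord (vbasis {:V}) i (f (vbasis {:V})`_i).
Proof. by apply: eq_bigr => i _; rewrite !mxE /= vecof_delta. Qed.

Lemma trace_sum (I : finType) (fs : I -> 'End(V)) :
  trace (\sum_i fs i) = \sum_i trace (fs i).
Proof. by rewrite /trace !linear_sum. Qed.

(** The functional is the coordinate of [f v] on a basis vector of the image. *)
Lemma rank1_form f : rank f = 1%N ->
  exists (u : V) (phi : {linear V -> F^o}), forall v, f v = phi v *: u.
Proof.
rewrite /rank => rk1; pose X := vbasis (limg f).
have lt0 : (0 < \dim (limg f))%N by rewrite rk1.
pose i0 := Ordinal lt0.
exists X`_0, (coord X i0 \o f) => v.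
rewrite [LHS](coord_vbasis (memv_img f (memvf v))) (bigD1 i0) //=.
rewrite big1 ?addr0 // => i /eqP[]; apply: val_inj.
by move: (ltn_ord i); rewrite {2}rk1 ltnS leqn0 => /eqP.
Qed.

(** With [f v = phi v *: u], both the scalar by which [f g] acts on [u] and the
    trace of [f g] are [phi (g u)]. *)
Lemma rank1_sandwich f g : rank f = 1%N ->
  (f \o g \o f)%VF = trace (f \o g)%VF *: f.
Proof.
case/rank1_form=> u [phi fE].
have -> : trace (f \o g)%VF = phi (g u).
  rewrite traceE [in RHS](coord_vbasis (memvf u)) !linear_sum.
  apply: eq_bigr => i _.
  by rewrite comp_lfunE fE !linearZ /= mulrC.
apply/lfunP=> v; rewrite !comp_lfunE scale_lfunE (fE v) !linearZ /= fE.
by rewrite !scalerA mulrC.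
Qed.

Lemma rank1_neq0 f : rank f = 1%N -> f != 0.
Proof.
by move=> rk1; apply/eqP=> f0; move: rk1; rewrite /rank f0 lim0g dimv0.
Qed.

Lemma trace_rank1_idempotent f : rank f = 1%N -> (f \o f)%VF = f ->
  trace f = 1.
Proof.
move=> rk1 ff; have := rank1_sandwich \1%VF rk1; rewrite comp_lfun1r ff => fE.
have /eqP : (trace f - 1) *: f = 0 by rewrite scalerBl scale1r -fE subrr.
by rewrite scaler_eq0 (negPf (rank1_neq0 rk1)) orbF subr_eq0 => /eqP.
Qed.

(** Nonzero vectors [u_i] in the images satisfy [P_j u_i = delta_ij u_i], so
    they are independent.  As there are [dim V] of them, they form a basis, and
    the sum of the [P_i] fixes each of them. *)
Lemma sum_rank1_idempotents n (P : 'I_n -> 'End(V)) :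
  \dim {:V} = n ->
  (forall i j, (P i \o P j)%VF = if i == j then P i else 0) ->
  (forall i, rank (P i) = 1%N) ->
  \sum_i P i = \1%VF.
Proof.
move=> dimV PP rk1; pose u i := vpick (limg (P i)).
have Pu i j : P i (u j) = if i == j then u j else 0.
  have /memv_imgP[w _ ->] : u j \in limg (P j) by apply: memv_pick.
  rewrite -comp_lfunE PP; case: eqP => [->//|_]; exact: zero_lfunE.
have u0 i : u i != 0 by rewrite vpick0 -dimv_eq0 [\dim _]rk1.
pose X := [tuple u i | i < n].
have XE (i : 'I_n) : X`_i = u i by rewrite -tnth_nth tnth_mktuple.
have freeX : free X.
  apply/freeP=> c c0 i; move/(congr1 (P i)): c0.
  rewrite linear_sum linear0 (bigD1 i) //= big1 => [|j ji].
    rewrite addr0 linearZ /= XE Pu eqxx => /eqP.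
    by rewrite scaler_eq0 (negPf (u0 i)) orbF => /eqP.
  by rewrite linearZ /= XE Pu eq_sym (negPf ji) scaler0.
have basisX : basis_of {:V} X.
  by rewrite basisEfree freeX subvf dimV size_tuple /=.
apply/lfunP=> v; rewrite id_lfunE {1 2}(coord_basis basisX (memvf v)) linear_sum.
apply: eq_bigr => i _; rewrite linearZ /= XE sum_lfunE (bigD1 i) //= Pu eqxx.
by rewrite big1 ?addr0 // => j ji; rewrite Pu (negPf ji).
Qed.

Definition commutator g f : 'End(V) := (f \o g)%VF - (g \o f)%VF.

Lemma commutator_linear g : linear (commutator g).
Proof.
move=> c f h; rewrite /commutator comp_lfunDl comp_lfunDr.
by rewrite -comp_lfunZl -comp_lfunZr scalerBr opprD addrACA.
Qed.

HB.instance Definition _ g :=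
  GRing.isSemilinear.Build F _ _ _ (commutator g)
    (GRing.semilinear_linear (commutator_linear g)).

(** The centralizer of [g], as the kernel of a linear map, is a subspace, and
    it is a subalgebra. *)
Lemma subalgebra_gen_comm (I : finType) (G : I -> 'End(V)) g f :
  (forall i, (G i \o g)%VF = (g \o G i)%VF) ->
  subalgebra_gen G f -> (f \o g)%VF = (g \o f)%VF.
Proof.
move=> Gg; pose C := lker (linfun (commutator g)).
have CP h : reflect ((h \o g)%VF = (g \o h)%VF) (h \in C).
  by rewrite memv_ker lfunE /= subr_eq0; apply: eqP.
move/(_ C)=> fC; apply/CP; apply: fC => [|i]; last exact/CP.
split=> [|Y Z /CP Yg /CP Zg]; apply/CP; first by rewrite comp_lfun1l comp_lfun1r.
by rewrite -comp_lfunA Zg comp_lfunA Yg comp_lfunA.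
Qed.

End RankOne.

(** The relation [Z E_0 E*_0 = rho(Z) E*_0] speaks of a product ending in
    [E*_0], whereas [k_i] is read on [A_i E_0].  Commuting [A_i] with [E_0] turns
    [k_i E_0 E*_0] into [E_0 A_i E*_0], where the relation applies. *)
Lemma eigenvalue_trace (F : fieldType) (d : nat) (V : vectType F)
    (E Es : 'I_d.+1 -> 'End(V)) (rho : 'End(V) -> 'End(V))
    (k : 'I_d.+1 -> F) (i : 'I_d.+1) :
  idempotent_system E Es -> is_rho_star E Es rho ->
  (A_elt E Es rho i \o E ord0)%VF = k i *: E ord0 ->
  k i = nu E Es * trace (E ord0 \o Es i)%VF.
Proof.
case=> idem rkE _ nz _ [rhoM _ rhoE] kE.
have EsM : subalgebra_gen Es (Es i) by move=> S _; apply.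
have E0comm j : (E j \o E ord0)%VF = (E ord0 \o E j)%VF.
  rewrite (idem j ord0).1 (idem ord0 j).1 [ord0 == j]eq_sym.
  by case: eqP => // ->.
have rhoC := subalgebra_gen_comm E0comm (rhoM _ EsM).
have EEs0 : (E ord0 \o Es ord0)%VF != 0.
  by apply/eqP=> e0; apply: (nz ord0); rewrite e0 comp_lfun0l.
(* Both scalars are compared through their multiples of [E_0 E*_0]. *)
apply/eqP; rewrite -subr_eq0 -[_ == 0]orbF -(negPf EEs0) -scaler_eq0 scalerBl.
rewrite subr_eq0 comp_lfunZl -kE /A_elt -comp_lfunZl rhoC -scalerA.
rewrite -comp_lfunZl -comp_lfunA -rhoE // !comp_lfunA.
by rewrite rank1_sandwich // -comp_lfunZl.
Qed.

Theorem lemma8p4 (F : fieldType) (d : nat) (V : vectType F)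
    (dimV : \dim {:V} = d.+1)
    (E Es : 'I_d.+1 -> 'End(V))
    (Phi_idem : idempotent_system E Es)
    (Phi_sym : symmetric_system E Es)
    (rho : 'End(V) -> 'End(V))
    (rhoP : is_rho_star E Es rho)
    (k : 'I_d.+1 -> F)
    (kP : forall i, (A_elt E Es rho i \o E ord0)%VF = k i *: E ord0) :
  [/\ forall i, k i <> 0,
      nu E Es = \sum_(i < d.+1) k i
    & k ord0 = 1].
Proof.
have kE i := eigenvalue_trace Phi_idem rhoP (kP i).
case: Phi_idem => idem rkE rkEs nz _.
have tr0 i : trace (E ord0 \o Es i)%VF != 0.
  apply/eqP=> t0; apply: (nz i).
  by rewrite rank1_sandwich // t0 scale0r.
have nu0 : nu E Es != 0 by rewrite invr_eq0.
split=> [i||].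
- by apply/eqP; rewrite kE mulf_neq0.
- under eq_bigr do rewrite kE.
  rewrite -mulr_sumr -trace_sum.
  rewrite -(big_morph _ (comp_lfunDr (E ord0)) (comp_lfun0r _ (E ord0))).
  rewrite sum_rank1_idempotents // => [|i j]; last by have [] := idem i j.
  rewrite comp_lfun1r trace_rank1_idempotent ?mulr1 //.
  by rewrite (idem ord0 ord0).1.
- by rewrite kE mulVf.
Qed.
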